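(* For $M>0$, let $q_M=\min(2,q')$, where $q'>1$ is the number such that $E(1\|q')=\ln(1/q')-(1-q')=M$, and let $p_M$ be the minimum of all $p'\ge 0$ with $E(p'\|1)=p'\ln p'-(p'-1)\le M$. Then there exists a constant $C>0$, independent of $M$, such that for every $M>0$ $$\frac{E(p_M\|q_M)}{M}<C.$$
   Context: The divergence function $E$ is defined for $p\ge 0$, $q>0$ by $E(p\|q)=p\ln(p/q)-(p-q)$, with the convention $0\ln 0=0$ (so $E(0\|q)=q$). *)

(* Defs.v *)
From Stdlib Require Import Reals Lra Psatz.
Open Scope R_scope.

(* Meaningful for [0 <= p] and [0 < q]. The convention [0 ln 0 = 0] needs no
   case split since [ln] is total on [R]; see [E_0_l]. *)
Definition E (p q : R) : R := p * ln (p / q) - (p - q).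

Definition is_minimum (S : R -> Prop) (m : R) : Prop :=
  S m /\ forall x, S x -> m <= x.

Definition is_qM (M q : R) : Prop :=
  exists q', 1 < q' /\ E 1 q' = M /\ q = Rmin 2 q'.

Definition is_pM (M p : R) : Prop :=
  is_minimum (fun p' => 0 <= p' /\ E p' 1 <= M) p.

Lemma E_0_l (q : R) : E 0 q = q.
Proof. unfold E; ring. Qed.

(* The rest of the file shows that, for [0 < M], the relations [is_qM M] and
   [is_pM M] each determine exactly one real number. *)

Lemma ln_le_sub1 (x : R) : 0 < x -> ln x <= x - 1.
Proof.
intros Hx. pose proof (exp_ineq1_le (ln x)) as H.
rewrite exp_ln in H by assumption. lra.
Qed.

Lemma E_1_l (q : R) : 0 < q -> E 1 q = q - 1 - ln q.
Proof.
intros Hq. unfold E, Rdiv. rewrite !Rmult_1_l, ln_Rinv by assumption. ring.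
Qed.

Lemma E_1_r (p : R) : E p 1 = p * ln p - (p - 1).
Proof. unfold E. now rewrite Rdiv_1_r. Qed.

Lemma E_1_l_increasing (a b : R) : 1 < a -> a < b -> E 1 a < E 1 b.
Proof.
intros Ha Hab. rewrite !E_1_l by lra.
assert (H : ln (b / a) <= b / a - 1) by (apply ln_le_sub1, Rdiv_lt_0_compat; lra).
unfold Rdiv in H at 1.
rewrite ln_mult, ln_Rinv in H by (try apply Rinv_0_lt_compat; lra).
assert (H2 : b / a - 1 < b - a).
{ replace (b / a - 1) with ((b - a) * / a) by (field; lra).
  assert (/ a < 1) by (rewrite <- Rinv_1; apply Rinv_lt_contravar; lra).
  nra. }
lra.
Qed.

Lemma E_1_r_decreasing (a b : R) : 0 < a -> a < b -> b < 1 -> E b 1 < E a 1.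
Proof.
intros Ha Hab Hb. rewrite !E_1_r.
assert (H : ln (b / a) <= b / a - 1) by (apply ln_le_sub1, Rdiv_lt_0_compat; lra).
unfold Rdiv in H at 1.
rewrite ln_mult, ln_Rinv in H by (try apply Rinv_0_lt_compat; lra).
assert (Hl : ln b < 0) by (rewrite <- ln_1; apply ln_increasing; lra).
assert (H2 : a * (ln b + - ln a) <= b - a).
{ replace (b - a) with (a * (b / a - 1)) by (field; lra).
  apply Rmult_le_compat_l; lra. }
nra.
Qed.

Lemma qM_exists_unique (M : R) : 0 < M -> exists! q, is_qM M q.
Proof.
intros HM.
set (f := fun x => exp x - 1 - x - M).
assert (Hc : continuity f) by (unfold f; apply derivable_continuous; reg).
assert (Hln : 0 < ln ((2 + M) * (2 + M)))
  by (rewrite <- ln_1; apply ln_increasing; nra).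
destruct (IVT f 0 (ln ((2 + M) * (2 + M))) Hc Hln) as [x [[Hx _] Hfx]].
- unfold f. rewrite exp_0. lra.
- unfold f. rewrite exp_ln, ln_mult by nra.
  pose proof (ln_le_sub1 (2 + M)). nra.
- unfold f in Hfx.
  assert (Hx0 : 0 < x).
  { destruct Hx as [Hx|<-]; [assumption|]. rewrite exp_0 in Hfx. lra. }
  pose proof (exp_ineq1 x).
  exists (Rmin 2 (exp x)); split.
  + exists (exp x). repeat split; [lra|].
    rewrite E_1_l by lra. rewrite ln_exp. lra.
  + intros q [q' [Hq' [HE ->]]]. f_equal.
    assert (HE2 : E 1 (exp x) = M) by (rewrite E_1_l, ln_exp by lra; lra).
    destruct (Rtotal_order (exp x) q') as [Hlt|[Heq|Hlt]]; [|assumption|].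
    * apply E_1_l_increasing in Hlt; lra.
    * apply E_1_l_increasing in Hlt; lra.
Qed.

Lemma pM_exists_unique (M : R) : 0 < M -> exists! p, is_pM M p.
Proof.
intros HM.
assert (Hex : exists p, is_pM M p).
{ destruct (Rle_lt_dec 1 M) as [H1|H1].
  { exists 0. split; [rewrite E_0_l; lra|]. now intros x [Hx _]. }
  set (f := fun x => M - (exp x * x - (exp x - 1))).
  assert (Hc : continuity f) by (unfold f; apply derivable_continuous; reg).
  set (e := (1 - M) / 2).
  assert (He : 0 < e < 1) by (unfold e; lra).
  assert (Hle : ln e < 0) by (rewrite <- ln_1; apply ln_increasing; lra).
  destruct (IVT_cor f (2 * ln e) 0 Hc) as [x [[_ Hx] Hfx]]; [lra| |].
  { assert (Hexp : exp (2 * ln e) = e * e).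
    { replace (2 * ln e) with (ln e + ln e) by ring.
      rewrite exp_plus, exp_ln by lra. reflexivity. }
    assert (H := ln_le_sub1 (/ e) (Rinv_0_lt_compat e (proj1 He))).
    rewrite ln_Rinv in H by lra.
    assert (H2 : e * - ln e <= 1 - e).
    { replace (1 - e) with (e * (/ e - 1)) by (field; lra).
      apply Rmult_le_compat_l; lra. }
    assert (f (2 * ln e) <= 0).
    { unfold f. rewrite Hexp. assert (M = 1 - 2 * e) by (unfold e; lra). nra. }
    assert (0 <= f 0) by (unfold f; rewrite exp_0; lra).
    nra. }
  unfold f in Hfx.
  assert (Hx0 : x < 0).
  { destruct Hx as [Hx| ->]; [assumption|]. rewrite exp_0 in Hfx. lra. }
  assert (Hex1 : exp x < 1) by (rewrite <- exp_0; apply exp_increasing; assumption).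
  pose proof (exp_pos x).
  assert (HE : E (exp x) 1 = M) by (rewrite E_1_r, ln_exp; lra).
  exists (exp x). split; [lra|].
  intros y [Hy HyM]. apply Rnot_lt_le. intros Hlt.
  destruct Hy as [Hy|<-].
  - pose proof (E_1_r_decreasing y (exp x) Hy Hlt Hex1). lra.
  - rewrite E_0_l in HyM. lra. }
destruct Hex as [p Hp]. exists p. split; [assumption|].
intros p' [H1 H2]. destruct Hp as [H3 H4]. apply Rle_antisym; auto.
Qed.

(* Main.v *)
(** The divergence is comparable to the squared distance: bounding [ln] by
    [ln x <= x - 1] on either side gives
    [(sqrt p - sqrt q)^2 <= E p q <= (p - q)^2 / q].
    Hence [E pM 1 <= M] and [E 1 qM <= M] force [1 - pM] and [qM - 1] to be
    [O(sqrt M)], so [E pM qM <= (qM - pM)^2] is [O(M)]. *)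
Require Import Defs.
From Stdlib Require Import Reals Lra Psatz.
Open Scope R_scope.

(** Passing to square roots [s], [t] makes the linear bound on [ln] sharp enough:
    [ln (p / q) = - 2 * ln (t / s)] and [ln (t / s) <= t / s - 1] leave [p + q - 2 * s * t]. *)
Lemma E_ge_sqr_sqrt_sub (p q : R) :
  0 <= p -> 0 < q -> (sqrt p - sqrt q) * (sqrt p - sqrt q) <= E p q.
Proof.
intros Hp Hq.
pose proof (sqrt_lt_R0 q Hq) as Ht.
pose proof (sqrt_sqrt q (Rlt_le _ _ Hq)) as Htq.
destruct Hp as [Hp|<-].
- pose proof (sqrt_lt_R0 p Hp) as Hs.
  pose proof (sqrt_sqrt p (Rlt_le _ _ Hp)) as Hsp.
  set (s := sqrt p) in *. set (t := sqrt q) in *.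
  assert (Hln : ln (p / q) = - 2 * ln (t / s)).
  { rewrite <- Hsp, <- Htq. unfold Rdiv.
    rewrite !ln_mult, !ln_Rinv, !ln_mult by (try apply Rinv_0_lt_compat; nra).
    ring. }
  pose proof (ln_le_sub1 (t / s) (Rdiv_lt_0_compat _ _ Ht Hs)) as Hle.
  assert (Hmul : p * ln (t / s) <= p * (t / s - 1))
    by (apply Rmult_le_compat_l; lra).
  assert (p * (t / s - 1) = s * t - p) by (rewrite <- Hsp; field; lra).
  unfold E. rewrite Hln. lra.
- rewrite E_0_l, sqrt_0. lra.
Qed.

Lemma sqr_sub_le_E (p q : R) :
  0 <= p -> 0 < q -> (p - q) * (p - q) <= 2 * (p + q) * E p q.
Proof.
intros Hp Hq.
pose proof (E_ge_sqr_sqrt_sub p q Hp Hq) as HE.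
pose proof (sqrt_sqrt p Hp) as Hsp.
pose proof (sqrt_sqrt q (Rlt_le _ _ Hq)) as Htq.
set (s := sqrt p) in *. set (t := sqrt q) in *.
apply Rle_trans with (2 * (p + q) * ((s - t) * (s - t))).
(* The right side minus the left is [(s - t)^4]. *)
- rewrite <- Hsp, <- Htq.
  pose proof (Rle_0_sqr ((s - t) * (s - t))). unfold Rsqr in *. nra.
- apply Rmult_le_compat_l; lra.
Qed.

Lemma E_le_sqr_sub_div (p q : R) :
  0 <= p -> 0 < q -> E p q <= (p - q) * (p - q) / q.
Proof.
intros Hp Hq.
replace ((p - q) * (p - q) / q) with (p * (p / q - 1) - (p - q))
  by (field; lra).
destruct Hp as [Hp|<-].
- unfold E. apply Rplus_le_compat_r, Rmult_le_compat_l; [lra|].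
  apply ln_le_sub1, Rdiv_lt_0_compat; assumption.
- rewrite E_0_l. lra.
Qed.

(** When the cap 2 is active, [E 1 q = M] weakens to an inequality by monotonicity. *)
Lemma is_qM_bounds (M q : R) : is_qM M q -> 1 < q <= 2 /\ E 1 q <= M.
Proof.
intros [q' [Hq' [<- ->]]].
destruct (Rlt_le_dec 2 q') as [H|H].
- rewrite Rmin_left by lra.
  pose proof (E_1_l_increasing 2 q'). lra.
- rewrite Rmin_right by lra. lra.
Qed.

Lemma is_pM_bounds (M p : R) : 0 < M -> is_pM M p -> 0 <= p <= 1 /\ E p 1 <= M.
Proof.
intros HM [[Hp HE] Hmin].
repeat split; try assumption.
(* The point 1 is admissible since [E 1 1 = 0]. *)
apply Hmin. rewrite E_1_r, ln_1. lra.
Qed.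

Theorem theorem2 :
  exists C : R, 0 < C /\
    forall M qM pM : R,
      0 < M -> is_qM M qM -> is_pM M pM -> E pM qM / M < C.
Proof.
(* The estimates below give [E p q <= 2 * (4 * M + 6 * M) = 20 * M]; 21 makes the inequality
   strict. *)
exists 21; split; [lra|].
intros M q p HM Hq Hp.
destruct (is_qM_bounds M q Hq) as [Hq12 HEq].
destruct (is_pM_bounds M p HM Hp) as [Hp01 HEp].
(* The factors 4 and 6 bound [2 * (p + 1)] and [2 * (1 + q)], using [p <= 1] and [q <= 2]. *)
assert (Hp4 : (p - 1) * (p - 1) <= 4 * M).
{ pose proof (sqr_sub_le_E p 1). nra. }
assert (Hq6 : (1 - q) * (1 - q) <= 6 * M).
{ pose proof (sqr_sub_le_E 1 q). nra. }
assert (Hpq : E p q <= (p - q) * (p - q)).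
{ eapply Rle_trans; [apply E_le_sqr_sub_div; lra|].
  apply Rmult_le_reg_r with q; [lra|].
  unfold Rdiv. rewrite Rmult_assoc, Rinv_l, Rmult_1_r by lra.
  pose proof (Rle_0_sqr (p - q)). unfold Rsqr in *. nra. }
apply Rmult_lt_reg_r with M; [assumption|].
unfold Rdiv. rewrite Rmult_assoc, Rinv_l, Rmult_1_r by lra.
(* With [a = p - 1] and [b = 1 - q], this is [(a + b)^2 <= 2 * a^2 + 2 * b^2]. *)
pose proof (Rle_0_sqr ((p - 1) - (1 - q))) as Hpar. unfold Rsqr in Hpar. nra.
Qed.
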